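(* Let $\mu_1,\mu_2\in\mathbb{C}$ with $|\mu_1|\leq 1$ and $|\mu_2|\leq 1$, and let $\Phi_1(z)=\mu_1 z$ and $\Phi_2(z)=\mu_2 z$ for $z\in\mathbb{C}$. Then the product $C_{\Phi_1}C_{\Phi_2}$ is an isometry on $H_E(\xi)$ if and only if $|\mu_1|=1$ and $|\mu_2|=1$. Moreover, the product $C_{\Phi_1}C_{\Phi_2}$ is unitary on $H_E(\xi)$ if and only if $|\mu_1|=1$ and $|\mu_2|=1$.
   Context: Let $\xi=(\xi_n)_{n\ge 0}$ be a sequence of positive real numbers with $\lim_{n\to\infty}\xi_n^{1/n}=\infty$. $H_E(\xi)$ is the Hilbert space of entire functions $f(z)=\sum_{n=0}^\infty a_n z^n$ with $\|f\|^2=\sum_{n=0}^\infty |a_n|^2\xi_n^2<\infty$, with inner product $\langle f,g\rangle=\sum_{n=0}^\infty b_n\overline{c_n}\,\xi_n^2$ for $f=\sum b_nz^n$, $g=\sum c_nz^n$. For an entire function $\Phi$, the composition operator is $C_\Phi f=f\circ\Phi$; for $\Phi(z)=\mu z$ with $|\mu|\le 1$ it is bounded on $H_E(\xi)$. A bounded operator $S$ is an isometry if $\|Sx\|=\|x\|$ for all $x$ (equivalently $S^*S=I$), and unitary if $S^*S=SS^*=I$. *)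

(* Defs.v *)
From Stdlib Require Import Reals Lra ClassicalEpsilon.
From Coquelicot Require Import Coquelicot.

Open Scope R_scope.

Definition entire (f : C -> C) : Prop :=
  forall z : C, @ex_derive C_AbsRing C_NormedModule f z.

Definition has_expansion (f : C -> C) (a : nat -> C) : Prop :=
  forall z : C, @is_pseries C_AbsRing C_NormedModule a z (f z).

Lemma expansion_proj (p : C -> R) (f : C -> C) (a : nat -> C) :
  (forall u v : C, p (u + v)%C = p u + p v) ->
  (forall (r : R) (u : C), p (RtoC r * u)%C = r * p u) ->
  (forall u v : C, Rabs (p u - p v) <= Cmod (u - v)%C) ->
  has_expansion f a ->
  forall x : R, is_pseries (fun n => p (a n)) x (p (f (RtoC x))).
Proof.
intros padd pscal pcont ha x.
assert (hpow : forall k, @pow_n C_Ring (RtoC x) k = RtoC (x ^ k)).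
{ induction k as [|k IH]; [reflexivity|].
  change (Cmult (RtoC x) (@pow_n C_Ring (RtoC x) k) = RtoC (x * x ^ k)).
  now rewrite IH, RtoC_mult. }
assert (hterm : forall k, p (Cmult (@pow_n C_Ring (RtoC x) k) (a k))
                = scal (pow_n x k) (p (a k))).
{ intros k. rewrite hpow, pscal, <- pow_n_pow. reflexivity. }
assert (hsum : forall n,
  p (@sum_n C_AbelianMonoid (fun k => Cmult (@pow_n C_Ring (RtoC x) k) (a k)) n)
  = sum_n (fun k => scal (pow_n x k) (p (a k))) n).
{ induction n as [|n IH].
  - rewrite !sum_O. apply hterm.
  - rewrite !sum_Sn.
    change (p (Cplus (@sum_n C_AbelianMonoid
      (fun k => Cmult (@pow_n C_Ring (RtoC x) k) (a k)) n)
      (Cmult (@pow_n C_Ring (RtoC x) (S n)) (a (S n))))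
      = sum_n (fun k => scal (pow_n x k) (p (a k))) n
        + scal (pow_n x (S n)) (p (a (S n)))).
    now rewrite padd, IH, hterm. }
specialize (ha (RtoC x)).
apply filterlim_locally. intros eps.
assert (h := proj1 (filterlim_locally_ball_norm _ _) ha eps).
revert h. apply filter_imp. intros n hn.
rewrite <- hsum.
apply Rle_lt_trans with (2 := hn).
apply pcont.
Qed.

Lemma entire_pseries_unique (a b : nat -> R) (g : R -> R) :
  (forall x, is_pseries a x (g x)) -> (forall x, is_pseries b x (g x)) ->
  forall n, a n = b n.
Proof.
assert (hrad : forall c, (forall x, is_pseries c x (g x)) -> Rbar_lt 0 (CV_radius c)).
{ intros c hc. destruct (Rbar_lt_le_dec 0 (CV_radius c)) as [h|h]; [exact h|].
  exfalso. apply (CV_disk_outside c 1).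
  - apply Rbar_le_lt_trans with (1 := h). simpl. rewrite Rabs_R1. lra.
  - assert (h1 := hc 1). apply is_pseries_R in h1.
    apply ex_series_lim_0. now exists (g 1). }
intros ha hb n. apply PSeries_ext_recip; auto.
apply filter_forall. intros x.
now rewrite (is_pseries_unique _ _ _ (ha x)), (is_pseries_unique _ _ _ (hb x)).
Qed.

Lemma has_expansion_unique (f : C -> C) (a b : nat -> C) :
  has_expansion f a -> has_expansion f b -> forall n, a n = b n.
Proof.
intros ha hb n. apply injective_projections.
- apply (entire_pseries_unique (fun n => fst (a n)) (fun n => fst (b n))
    (fun x => fst (f (RtoC x)))); intros x; apply (expansion_proj fst); auto;
  try (intros; simpl; ring);
  intros u v; apply Rle_trans with (2 := Rmax_Cmod _); apply Rmax_l.
- apply (entire_pseries_unique (fun n => snd (a n)) (fun n => snd (b n))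
    (fun x => snd (f (RtoC x)))); intros x; apply (expansion_proj snd); auto;
  try (intros; simpl; ring);
  intros u v; apply Rle_trans with (2 := Rmax_Cmod _); apply Rmax_r.
Qed.

(* Unspecified when f has no everywhere convergent expansion. *)
Definition coef (f : C -> C) : nat -> C :=
  epsilon (inhabits (fun _ : nat => RtoC 0)) (has_expansion f).

Lemma coefE (f : C -> C) (a : nat -> C) :
  has_expansion f a -> forall n, coef f n = a n.
Proof.
intros ha. apply (has_expansion_unique f); [|exact ha].
unfold coef. apply epsilon_spec. now exists a.
Qed.

Definition in_HE (xi : nat -> R) (f : C -> C) : Prop :=
  entire f /\
  exists a : nat -> C, has_expansion f a /\
    ex_series (fun n => Cmod (a n) ^ 2 * xi n ^ 2).

Definition HE_norm (xi : nat -> R) (f : C -> C) : R :=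
  sqrt (Series (fun n => Cmod (coef f n) ^ 2 * xi n ^ 2)).

(* Coquelicot's Series is real-valued: the complex series is summed by real and
   imaginary parts. *)
Definition HE_inner (xi : nat -> R) (f g : C -> C) : C :=
  let t n := (coef f n * Cconj (coef g n) * RtoC (xi n ^ 2))%C in
  (Series (fun n => Re (t n)), Series (fun n => Im (t n))).

(* Operators on H_E(xi) are maps on all functions C -> C; every property below
   only concerns their values on H_E(xi). *)
Definition bounded_operator (xi : nat -> R) (S : (C -> C) -> (C -> C)) : Prop :=
  (forall f, in_HE xi f -> in_HE xi (S f)) /\
  (forall (c : C) (f g : C -> C), in_HE xi f -> in_HE xi g ->
     forall z : C, S (fun w => c * f w + g w)%C z = (c * S f z + S g z)%C) /\
  (exists M : R, forall f, in_HE xi f -> HE_norm xi (S f) <= M * HE_norm xi f).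

Definition isometry (xi : nat -> R) (S : (C -> C) -> (C -> C)) : Prop :=
  bounded_operator xi S /\ forall f, in_HE xi f -> HE_norm xi (S f) = HE_norm xi f.

Definition is_adjoint (xi : nat -> R) (S T : (C -> C) -> (C -> C)) : Prop :=
  bounded_operator xi T /\
  forall f g, in_HE xi f -> in_HE xi g -> HE_inner xi (S f) g = HE_inner xi f (T g).

Definition unitary (xi : nat -> R) (S : (C -> C) -> (C -> C)) : Prop :=
  bounded_operator xi S /\
  exists T, is_adjoint xi S T /\
    (forall f, in_HE xi f -> forall z : C, T (S f) z = f z) /\
    (forall f, in_HE xi f -> forall z : C, S (T f) z = f z).

Definition comp_op (Phi : C -> C) : (C -> C) -> (C -> C) :=
  fun f z => f (Phi z).

(* Main.v *)
Require Import Defs.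
From Stdlib Require Import Reals Lra Lia FunctionalExtensionality.
From Coquelicot Require Import Coquelicot.

Open Scope R_scope.

(* The product is the dilation [f(z) |-> f(mu z)] with [mu = mu2 mu1], which
   multiplies the n-th Taylor coefficient by [mu^n].  If [|mu| = 1] it preserves
   norms, and the dilation by [Cconj mu] is both its inverse and its adjoint.
   Conversely a unitary operator is an isometry, and an isometric dilation must
   preserve the norm [xi 1] of [z |-> z], so [|mu| = 1]; as both factors have
   modulus at most 1, both have modulus exactly 1. *)

(** The partial sums are constant from index [N] on. This evaluates both series attached to [c * z],
    whose only coefficient sits at index 1. *)
Lemma is_series_finite_support {K : AbsRing} {V : NormedModule K}
  (a : nat -> V) (N : nat) :
  (forall n, (N < n)%nat -> a n = zero) -> is_series a (sum_n a N).
Proof.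
intros ha.
apply (filterlim_ext_loc (fun _ => sum_n a N)); [|apply filterlim_const].
exists N. intros n hn.
induction hn as [|n hn IH]; [reflexivity|].
rewrite sum_Sn, <- IH, ha, plus_zero_r; [reflexivity|lia].
Qed.

Lemma entire_linear (c : C) : entire (fun z => c * z)%C.
Proof.
intros z. exists c.
(* Written as [scal w c], the map is linear in [w], hence its own differential. *)
apply (filterdiff_ext (fun w : C_AbsRing => @scal _ C_NormedModule w c)).
{ intros w. apply Cmult_comm. }
apply filterdiff_linear. apply (@is_linear_scal_l C_AbsRing C_NormedModule).
Qed.

(* Coquelicot puts two normed module structures on [C]: the inner function of
   [ex_derive_comp] lives in [AbsRing_NormedModule C_AbsRing], whereas
   [entire_linear] is about [C_NormedModule]. *)
Lemma ex_derive_Cmult_l (c z : C) :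
  @ex_derive C_AbsRing (AbsRing_NormedModule C_AbsRing) (fun w => c * w)%C z.
Proof.
exists c.
apply (filterdiff_ext
  (fun w : C_AbsRing => @scal _ (AbsRing_NormedModule C_AbsRing) w c)).
{ intros w. apply Cmult_comm. }
apply filterdiff_linear.
apply (@is_linear_scal_l C_AbsRing (AbsRing_NormedModule C_AbsRing)).
Qed.

Lemma entire_dilation (f : C -> C) (mu : C) :
  entire f -> entire (fun z => f (mu * z)%C).
Proof.
intros hf z.
apply (@ex_derive_comp C_AbsRing C_NormedModule f (fun w => mu * w)%C z (hf _)).
apply ex_derive_Cmult_l.
Qed.

Lemma has_expansion_linear (c : C) :
  has_expansion (fun z => c * z)%C (fun n => if Nat.eqb n 1 then c else RtoC 0).
Proof.
intros z.
evar_last.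
- apply (is_series_finite_support _ 1).
  intros [|[|n]] hn; try lia. apply Cmult_0_r.
- rewrite sum_Sn, sum_O.
  change ((RtoC 1 * RtoC 0 + (z * RtoC 1) * c)%C = (c * z)%C). ring.
Qed.

Lemma has_expansion_dilation (f : C -> C) (a : nat -> C) (mu : C) :
  has_expansion f a ->
  has_expansion (fun z => f (mu * z)%C) (fun n => (mu ^ n * a n)%C).
Proof.
intros ha z. generalize (ha (mu * z)%C).
apply is_series_ext. intros n.
change (@pow_n C_Ring (mu * z)%C n * a n
  = @pow_n C_Ring z n * (mu ^ n * a n))%C.
enough (h : (@pow_n C_Ring (mu * z)%C n = mu ^ n * @pow_n C_Ring z n)%C)
  by (rewrite h; ring).
induction n as [|n IH]; simpl.
- unfold one; simpl. ring.
- rewrite IH. unfold mult; simpl. ring.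
Qed.

(** [coef] is a choice, so the expansion [a] serves to pin it down on both sides by uniqueness. *)
Lemma coef_dilation (f : C -> C) (a : nat -> C) (mu : C) :
  has_expansion f a ->
  forall n, coef (fun z => f (mu * z)%C) n = (mu ^ n * coef f n)%C.
Proof.
intros ha n.
rewrite (coefE _ _ (has_expansion_dilation f a mu ha)).
now rewrite (coefE _ _ ha).
Qed.

Lemma is_series_linear_norm (xi : nat -> R) (c : C) :
  is_series (fun n => Cmod (if Nat.eqb n 1 then c else RtoC 0) ^ 2 * xi n ^ 2)
    ((Cmod c * xi 1%nat) ^ 2).
Proof.
evar_last.
- apply (is_series_finite_support _ 1).
  intros [|[|n]] hn; try lia.
  unfold zero; simpl. rewrite Cmod_0. ring.
- rewrite sum_Sn, sum_O. unfold plus; simpl. rewrite Cmod_0. ring.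
Qed.

Lemma in_HE_linear (xi : nat -> R) (c : C) : in_HE xi (fun z => c * z)%C.
Proof.
split; [apply entire_linear|].
eexists; split; [apply has_expansion_linear|].
eexists; apply is_series_linear_norm.
Qed.

Lemma HE_norm_linear (xi : nat -> R) (c : C) :
  0 <= xi 1%nat -> HE_norm xi (fun z => c * z)%C = Cmod c * xi 1%nat.
Proof.
intros hxi. unfold HE_norm.
rewrite (Series_ext _ _ (fun n =>
  f_equal (fun u => Cmod u ^ 2 * xi n ^ 2) (coefE _ _ (has_expansion_linear c) n))).
rewrite (is_series_unique _ _ (is_series_linear_norm xi c)).
apply sqrt_pow2, Rmult_le_pos; [apply Cmod_ge_0|exact hxi].
Qed.

(** Each term [c * Cconj c] is the real number [Cmod c ^ 2]. This turns an adjoint identity into a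
    statement about norms. *)
Lemma HE_norm_inner (xi : nat -> R) (f : C -> C) :
  HE_norm xi f = sqrt (Re (HE_inner xi f f)).
Proof.
unfold HE_norm, HE_inner. f_equal. apply Series_ext. intros n.
rewrite <- Cmod2_conj, <- RtoC_mult. reflexivity.
Qed.

(** With [T] the adjoint, <S f, S f> = <f, T (S f)> = <f, f>. *)
Lemma unitary_isometry (xi : nat -> R) (S : (C -> C) -> (C -> C)) :
  unitary xi S -> isometry xi S.
Proof.
intros [hS [T [[_ hadj] [hTS _]]]]. split; [exact hS|].
intros f hf. rewrite !HE_norm_inner, hadj; [|assumption|now apply hS].
now rewrite (functional_extensionality _ _ (hTS f hf)).
Qed.

(** Since [mu ^ n] has modulus 1, the series of squared norms is unchanged term by term. *)
Lemma in_HE_dilation (xi : nat -> R) (mu : C) (f : C -> C) :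
  Cmod mu = 1 -> in_HE xi f -> in_HE xi (fun z => f (mu * z)%C).
Proof.
intros hmu [hf [a [ha hs]]]. split; [now apply entire_dilation|].
eexists; split; [now apply has_expansion_dilation, ha|].
revert hs. apply ex_series_ext. intros n.
now rewrite Cmod_mult, Cmod_pow, hmu, pow1, Rmult_1_l.
Qed.

Lemma HE_norm_dilation (xi : nat -> R) (mu : C) (f : C -> C) :
  Cmod mu = 1 -> in_HE xi f ->
  HE_norm xi (fun z => f (mu * z)%C) = HE_norm xi f.
Proof.
intros hmu [_ [a [ha _]]]. unfold HE_norm. f_equal.
apply Series_ext. intros n. rewrite (coef_dilation f a mu ha).
now rewrite Cmod_mult, Cmod_pow, hmu, pow1, Rmult_1_l.
Qed.

Lemma Cconj_pow (c : C) (n : nat) : Cconj (c ^ n)%C = (Cconj c ^ n)%C.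
Proof.
induction n as [|n IH]; simpl.
- apply injective_projections; simpl; ring.
- now rewrite Cmult_conj, IH.
Qed.

(** The two series agree term by term: the factor [mu ^ n] on the left is the conjugate of
    [Cconj mu ^ n] on the right. *)
Lemma HE_inner_dilation (xi : nat -> R) (mu : C) (f g : C -> C) :
  in_HE xi f -> in_HE xi g ->
  HE_inner xi (fun z => f (mu * z)%C) g
  = HE_inner xi f (fun z => g (Cconj mu * z)%C).
Proof.
intros [_ [a [ha _]]] [_ [b [hb _]]].
assert (h : forall n,
  (coef (fun z => f (mu * z)%C) n * Cconj (coef g n) * RtoC (xi n ^ 2))%C
  = (coef f n * Cconj (coef (fun z => g (Cconj mu * z)%C) n)
     * RtoC (xi n ^ 2))%C).
{ intros n. rewrite (coef_dilation f a mu ha), (coef_dilation g b _ hb).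
  rewrite Cmult_conj, Cconj_pow, Cconj_conj. ring. }
apply injective_projections; apply Series_ext; intros n; now rewrite h.
Qed.

Lemma dilation_isometry (xi : nat -> R) (mu : C) :
  Cmod mu = 1 -> isometry xi (fun f z => f (mu * z)%C).
Proof.
intros hmu. split; [|intros f; now apply HE_norm_dilation].
split; [|split].
- intros f. now apply in_HE_dilation.
(* Linearity holds by computation: both sides evaluate [f] and [g] at [mu * z]. *)
- reflexivity.
- exists 1. intros f hf. rewrite HE_norm_dilation; auto. lra.
Qed.

Lemma dilation_unitary (xi : nat -> R) (mu : C) :
  Cmod mu = 1 -> unitary xi (fun f z => f (mu * z)%C).
Proof.
intros hmu. split; [now apply dilation_isometry|].
assert (hinv : (mu * Cconj mu)%C = RtoC 1).
{ rewrite <- Cmod2_conj, hmu, pow1. reflexivity. }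
exists (fun f z => f (Cconj mu * z)%C). split; [split|split].
- apply dilation_isometry. now rewrite Cmod_conj.
- intros f g. apply HE_inner_dilation.
- intros f _ z. now rewrite Cmult_assoc, hinv, Cmult_1_l.
- intros f _ z. now rewrite Cmult_assoc, (Cmult_comm _ mu), hinv, Cmult_1_l.
Qed.

Lemma isometry_dilation_Cmod (xi : nat -> R) (mu : C) :
  0 < xi 1%nat -> isometry xi (fun f z => f (mu * z)%C) -> Cmod mu = 1.
Proof.
intros hxi [_ hiso].
assert (h := hiso _ (in_HE_linear xi (RtoC 1))). cbv beta in h.
replace (fun z => RtoC 1 * (mu * z))%C with (fun z => mu * z)%C in h
  by (apply functional_extensionality; intros z; ring).
rewrite !HE_norm_linear, Cmod_1 in h by lra.
(* Here [h] reads [Cmod mu * xi 1 = 1 * xi 1]; the positive weight cancels. *)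
now apply Rmult_eq_reg_r in h; [|lra].
Qed.

Theorem theorem2p5 (xi : nat -> R)
  (xi_pos : forall n : nat, 0 < xi n)
  (xi_lim : is_lim_seq (fun n => Rpower (xi n) (/ INR n)) p_infty)
  (mu1 mu2 : C) (hmu1 : Cmod mu1 <= 1) (hmu2 : Cmod mu2 <= 1)
  (Phi1 Phi2 : C -> C)
  (hPhi1 : forall z : C, Phi1 z = (mu1 * z)%C)
  (hPhi2 : forall z : C, Phi2 z = (mu2 * z)%C) :
  (isometry xi (fun f => comp_op Phi1 (comp_op Phi2 f)) <->
     Cmod mu1 = 1 /\ Cmod mu2 = 1) /\
  (unitary xi (fun f => comp_op Phi1 (comp_op Phi2 f)) <->
     Cmod mu1 = 1 /\ Cmod mu2 = 1).
Proof.
(* Composition operators compose in reverse: the product sends [f] to [f (Phi2 (Phi1 z))]. *)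
replace (fun f => comp_op Phi1 (comp_op Phi2 f))
  with (fun (f : C -> C) z => f (mu2 * mu1 * z)%C)
  by (apply functional_extensionality; intros f;
      apply functional_extensionality; intros z;
      unfold comp_op; now rewrite hPhi2, hPhi1, Cmult_assoc).
assert (hmod : Cmod (mu2 * mu1)%C = 1 <-> Cmod mu1 = 1 /\ Cmod mu2 = 1).
{ rewrite Cmod_mult.
  assert (h1 := Cmod_ge_0 mu1). assert (h2 := Cmod_ge_0 mu2).
  (* Two numbers in [0, 1] with product 1 are both 1, as the product is at most either factor. *)
  split; [intros h; split; nra|intros [-> ->]; ring]. }
rewrite <- hmod. split; split.
- apply isometry_dilation_Cmod, xi_pos.
- apply dilation_isometry.
- intros h. now apply (isometry_dilation_Cmod xi), unitary_isometry.
- apply dilation_unitary.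
Qed.
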